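(* Let $n\ge 1$, $m\ge 2$, $t\ge 3$ be integers, and let $r=mt-a$ where $a$ is an integer with $2\le a\le \min\{m,t-1\}$. Suppose that (i) $r\ge a(3t-1)$, or (ii) $\frac{r}{t(3t-1)(m-1)}-\frac{a}{t(m-1)}+\frac{a-1}{mt-2}\ge \frac1n$. Then $$(r-1)n-(m-1)\left\lceil \frac{(r-1)n}{mt-2}\right\rceil\le f(n,r,t+1)\le (r-1)n-\left\lceil \frac{(m-1)(r-1)n}{mt-2}\right\rceil.$$
   Context: For positive integers $n,r$ and $s\ge 2$, an $r$-partite graph with parts of size $n$ is a graph $G$ whose vertex set is partitioned into $r$ independent sets $V_1,\dots,V_r$, each of size $n$. $f(n,r,s)$ denotes the largest minimum degree $\delta(G)$ among all $r$-partite graphs $G$ with parts of size $n$ that contain no copy of the complete graph $K_{s}$. *)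

(* Defs.v *)
From mathcomp Require Export all_boot all_order all_algebra.

Set Implicit Arguments.
Unset Strict Implicit.
Unset Printing Implicit Defensive.

Section Graphs.
Variable V : finType.
Implicit Types (e : rel V) (x y : V) (S : {set V}).

Definition simple_graph e : bool :=
  [forall x, ~~ e x x] && [forall x, forall y, e x y == e y x].

Definition degree e x : nat := #|[set y | e x y]|.

(* The default value #|V| exceeds every degree of a simple graph, so it is
   returned only when V is empty. *)
Definition min_degree e : nat := \big[minn/#|V|]_(x : V) degree e x.

Definition clique e S : bool :=
  [forall x in S, forall y in S, (x != y) ==> e x y].

Definition has_complete_subgraph (s : nat) e : bool :=
  [exists S : {set V}, (#|S| == s) && clique e S].

Definition parts_independent (r : nat) (part : V -> 'I_r) e : bool :=
  [forall x, forall y, (part x == part y) ==> ~~ e x y].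

End Graphs.

(* The vertex (i, k) is the k-th vertex of the part V_i. Up to isomorphism every
   r-partite graph with parts of size n has this vertex set; see fmax_ub. *)
Definition vertex (n r : nat) : finType := ('I_r * 'I_n)%type.

Definition rel_of (V : finType) (g : {ffun V * V -> bool}) : rel V :=
  fun x y => g (x, y).

Definition admissible (n r s : nat) (e : rel (vertex n r)) : bool :=
  [&& simple_graph e, parts_independent (fun x : vertex n r => x.1) e
    & ~~ has_complete_subgraph s e].

(* The maximum is over a nonempty set when s >= 2: the edgeless graph is
   admissible. *)
Definition fmax (n r s : nat) : nat :=
  \max_(g : {ffun vertex n r * vertex n r -> bool} | admissible s (rel_of g))
    min_degree (rel_of g).

Lemma fmax_attained (n r s : nat) : 1 < s ->
  exists2 e : rel (vertex n r), admissible s e & min_degree e = fmax n r s.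
Proof.
move=> s1.
have adm0 : admissible s (rel_of [ffun=> false : bool] : rel (vertex n r)).
  apply/and3P; split.
  - apply/andP; split; first by apply/forallP => x; rewrite /rel_of ffunE.
    by apply/forallP => x; apply/forallP => y; rewrite /rel_of !ffunE.
  - by apply/forallP => x; apply/forallP => y; rewrite /rel_of ffunE implybT.
  - apply/existsP => -[S /andP [/eqP cS /forall_inP cl]].
    move: s1; rewrite -cS => /card_gt1P [x [y [xS yS xy]]].
    by move: (cl x xS) => /forall_inP /(_ y yS); rewrite xy /rel_of ffunE.
pose A := [pred g : {ffun vertex n r * vertex n r -> bool} |
  admissible s (rel_of g)].
have A0 : 0 < #|A| by apply/card_gt0P; exists [ffun=> false].
have [g gA gE] := eq_bigmax_cond (fun g => min_degree (rel_of g)) A0.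
by exists (rel_of g).
Qed.

Lemma fmax_ub (n r s : nat) (V : finType) (part : V -> 'I_r) (e : rel V) :
  (forall i, #|[set x | part x == i]| = n) ->
  simple_graph e -> parts_independent part e -> ~~ has_complete_subgraph s e ->
  min_degree e <= fmax n r s.
Proof.
move=> cp /andP [/forallP ir /forallP sy] /forallP pi /existsPn nk.
have inP x : x \in [set y | part y == part x] by rewrite inE.
pose h (p : vertex n r) : V := enum_val (cast_ord (esym (cp p.1)) p.2).
have ph p : part (h p) = p.1.
  by have := enum_valP (cast_ord (esym (cp p.1)) p.2); rewrite inE => /eqP.
have h_inj : injective h.
  move=> [i k] [j l] E; have ij : i = j by have := ph (i, k); rewrite E ph.
  by subst j; move: E => /enum_val_inj /cast_ord_inj /= ->.
pose h' x : vertex n r := (part x, cast_ord (cp _) (enum_rank_in (inP x) x)).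
have h'K : cancel h' h by move=> x; rewrite /h /= cast_ordK enum_rankK_in.
have hK : cancel h h' by move=> p; apply: h_inj; rewrite h'K.
pose g : {ffun vertex n r * vertex n r -> bool} := [ffun p => e (h p.1) (h p.2)].
have gE x y : rel_of g x y = e (h x) (h y) by rewrite /rel_of ffunE.
have adm : admissible s (rel_of g).
  apply/and3P; split.
  - apply/andP; split; first by apply/forallP => x; rewrite gE.
    by apply/forallP => x; apply/forallP => y; rewrite !gE; apply: (forallP (sy _)).
  - apply/forallP => x; apply/forallP => y; rewrite gE -!ph.
    exact: (forallP (pi _)).
  - apply/existsP => -[S /andP [/eqP cS /forall_inP cl]].
    move: (nk (h @: S)); rewrite card_imset // cS eqxx /= => /negP; apply.
    apply/forall_inP => _ /imsetP [x xS ->]; apply/forall_inP => _ /imsetP [y yS ->].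
    by rewrite (inj_eq h_inj) -gE; apply: (forall_inP (cl x xS)).
have degE x : degree (rel_of g) x = degree e (h x).
  rewrite /degree -(card_imset _ h_inj); apply: eq_card => y.
  rewrite inE; apply/imsetP/idP => [[z]|exy]; first by rewrite inE gE => ? ->.
  by exists (h' y); rewrite ?inE ?gE h'K.
have := @leq_bigmax_cond _ (fun g => admissible s (rel_of g))
  (fun g => min_degree (rel_of g)) g adm.
apply: leq_trans.
have cV : #|vertex n r| = #|V| := bij_eq_card (Bijective hK h'K).
have min0 : min_degree e <= #|V|.
  by rewrite /min_degree; elim/big_rec: _ => // x k _; rewrite geq_min orbC => ->.
have minx x : min_degree e <= degree e x.
  rewrite /min_degree; have := mem_index_enum x.
  elim: (index_enum V) => // y l IH; rewrite inE big_cons geq_min.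
  by case/predU1P => [->|/IH ->]; rewrite ?leqnn ?orbT.
rewrite {2}/min_degree cV; elim/big_ind: _ => // [x y|x _].
  by rewrite leq_min => -> ->.
by rewrite degE.
Qed.

(* Main.v *)
Require Import Defs.
From mathcomp Require Import zify ring.
Import Order.TTheory GRing.Theory Num.Theory.

Set Implicit Arguments.
Unset Strict Implicit.
Unset Printing Implicit Defensive.

(** Upper bound. If the minimum degree exceeded the bound, either of the two
    conditions would push it above (3t-4)/(3t-1) times the number of vertices,
    so by the Andrasfai-Erdos-Sos theorem the graph would be t-colourable. Let
    x_ij be the number of vertices of part i with colour j, let u_j be the size
    of colour class j, and let D = (r-1)n - delta, so that u_j <= D + x_ij
    whenever x_ij > 0. If (mt-2)D < (m-1)(r-1)n, then (mt-2)u_j <= m(r-1)n for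
    all j, and a part meeting two classes would make the classes too small to
    cover all vertices. So every part lies in a single class; as r > t(m-1),
    some class contains m parts, whence (m-1)n <= D, a contradiction.

    Lower bound. With x = ceil((r-1)n/(mt-2)), colour x vertices of each of the
    first m(t-1) parts with t-1 colours, m parts per colour, colour all remaining
    vertices with the last colour, and join vertices that differ both in part
    and in colour. *)

(** * Class sizes in a coloured multipartite graph *)

Lemma class_sizes_bound (n m t a r D : nat) (x : 'I_r -> 'I_t -> nat) :
  0 < n -> 1 < m -> 0 < a < t -> r = m * t - a ->
  (forall i, \sum_j x i j = n) ->
  (forall i j, 0 < x i j -> \sum_k x k j <= D + x i j) ->
  (m - 1) * (r - 1) * n <= (m * t - 2) * D.
Proof.
move=> n0 m1 /andP[a0 at_] rE row col; rewrite leqNgt; apply/negP => hD.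
have mt : m * a + m <= m * t by rewrite -mulnSr leq_mul2l at_ orbT.
have ma : a + a <= m * a by nia.
pose u j := \sum_k x k j.
have xn i j : x i j <= n by rewrite -(row i) (bigD1 j) //= leq_addr.
have hu j : (m * t - 2) * u j <= m * (r - 1) * n.
  pose K := [set i | 0 < x i j].
  have uK : u j = \sum_(i in K) x i j.
    rewrite /u (bigID (mem K)) /= [X in _ + X]big1 ?addn0 // => i.
    by rewrite inE -eqn0Ngt => /eqP.
  (* If fewer than [m] parts meet class j, then u_j <= (m-1)n. If k >= m parts do, summing u_j <= D
     + x_ij over them gives (k-1)u_j <= kD, and k/(k-1) <= m/(m-1). *)
  have [km|mk] := ltnP #|K| m.
    have : u j <= #|K| * n by rewrite uK -sum_nat_const; apply: leq_sum.
    move=> h; have {h} : u j <= (m - 1) * n.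
      by apply: leq_trans h _; rewrite leq_mul2r; apply/orP; right; lia.
    move=> h; apply: leq_trans (_ : (m * t - 2) * ((m - 1) * n) <= _).
      by rewrite leq_mul2l h orbT.
    rewrite mulnA leq_mul2r; apply/orP; right; subst r; nia.
  have hk : #|K| * u j <= #|K| * D + u j.
    rewrite -!sum_nat_const [X in _ <= _ + X]uK -big_split /=.
    by apply: leq_sum => i; rewrite inE => /col.
  have : (m - 1) * u j <= m * D.
    have k1 : 0 < #|K| - 1 by lia.
    rewrite -(leq_pmul2l k1).
    have h1 : (#|K| - 1) * u j <= #|K| * D by nia.
    have h2 : (m - 1) * #|K| <= m * (#|K| - 1) by nia.
    have h3 : (m - 1) * ((#|K| - 1) * u j) <= (m - 1) * (#|K| * D)
      by rewrite leq_mul2l h1 orbT.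
    have h4 : (m - 1) * #|K| * D <= m * (#|K| - 1) * D
      by rewrite leq_mul2r h2 orbT.
    nia.
  move=> h; have m1' : 0 < m - 1 by lia.
  rewrite -(leq_pmul2l m1').
  have h1 : (m * t - 2) * ((m - 1) * u j) <= (m * t - 2) * (m * D)
    by rewrite leq_mul2l h orbT.
  have h2 : m * ((m * t - 2) * D) <= m * ((m - 1) * (r - 1) * n)
    by rewrite leq_mul2l (ltnW hD) orbT.
  nia.
have tot : \sum_j u j = r * n.
  rewrite exchange_big /=; under eq_bigr do rewrite row.
  by rewrite sum_nat_const card_ord.
(* If part [i] met both classes, they would hold at most 2D + n vertices, and [hu] bounds the other
   t-2 classes. As 2(m-1) + (t-2)m = mt-2, the total would be strictly below rn. *)
have single i j j' : 0 < x i j -> 0 < x i j' -> j = j'.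
  move=> xj xj'; apply/eqP/negPn/negP => jj'.
  have jj2 : j' != j by rewrite eq_sym.
  have h : x i j + x i j' <= n.
    by rewrite -(row i) (bigD1 j) //= (bigD1 j') //= addnA leq_addr.
  move: tot; rewrite (bigD1 j) //= (bigD1 j') //=.
  set S := \sum_(_ | _) _ => tot.
  have hS : (m * t - 2) * S <= (t - 2) * (m * (r - 1) * n).
    rewrite big_distrr /=; apply: leq_trans (leq_sum _ _) _ => [k _|]; first exact: hu.
    rewrite sum_nat_const leq_mul2r; apply/orP; right.
    apply: leq_trans (_ : #|[predC [set j; j']]| <= _).
      by apply: subset_leq_card; apply/subsetP => k; rewrite !inE negb_or.
    by have := cardC [set j; j']; rewrite cards2 jj' /= card_ord; lia.
  have h1 := col _ _ xj; have h2 := col _ _ xj'.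
  have h3 : r * n <= 2 * D + n + S.
    by rewrite -tot; move: h1 h2; rewrite -!/(u _); lia.
  have h4 : (m * t - 2) * (r * n) <= (m * t - 2) * (2 * D + n + S)
    by rewrite leq_mul2l h3 orbT.
  have h5 : 2 * ((m - 1) * (r - 1) * n) + (t - 2) * (m * (r - 1) * n) = (m * t - 2) * ((r - 1) * n).
    rewrite -!mulnA mulnA (mulnA (t - 2)) -mulnDl; congr (_ * _).
    have t2 : 2 <= t by lia.
    nia.
  have h6 : r * n = (r - 1) * n + n by nia.
  nia.
have full i j : 0 < x i j -> x i j = n.
  move=> xj; rewrite -(row i) (bigD1 j) //= big1 ?addn0 // => k kj.
  by apply/eqP; rewrite eqn0Ngt; apply/negP => /single /(_ xj) E; rewrite E eqxx in kj.
(* Pigeonhole: a < t gives r > t(m-1). *)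
have [j hj] : exists j, (m - 1) * n < u j.
  apply/existsP; apply: contraT; rewrite negb_exists => /forallP h.
  have : \sum_j u j <= \sum_(j < t) (m - 1) * n.
    by apply: leq_sum => j _; rewrite leqNgt h.
  rewrite tot sum_nat_const card_ord mulnA leq_pmul2r //; subst r; nia.
have [i xi] : exists i, 0 < x i j.
  apply/existsP; apply: contraT; rewrite negb_exists => /forallP h.
  by move: hj; rewrite /u big1 // => i _; apply/eqP; rewrite eqn0Ngt h.
have hc := col _ _ xi.
have uE : u j = #|[set i | 0 < x i j]| * n.
  rewrite -sum_nat_const /u (bigID (mem [set i | 0 < x i j])) /= [X in _ + X]big1 ?addn0.
    by apply: eq_bigr => k; rewrite inE => /full.
  by move=> k; rewrite inE -eqn0Ngt => /eqP.
have mn : m * n <= u j by move: hj; rewrite uE ltn_pmul2r // leq_pmul2r //; lia.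
have hDn : (m - 1) * n <= D by move: hc mn; rewrite -/(u j) (full _ _ xi); nia.
(* Since a >= 1, r-1 <= mt-2; hence (m-1)n <= D contradicts [hD]. *)
have : (r - 1) * ((m - 1) * n) <= (m * t - 2) * D.
  by apply: leq_mul => //; lia.
nia.
Qed.

(** * The Andrasfai-Erdos-Sos theorem *)

(** Weight 3 on [A] vertices and weight 1 on [C] others total at most A + 2t + 1 <= 3t-1. The last
    hypothesis then gives (3t-1)d <= (3t-4)N. *)
Lemma missed_weight_contradiction (t d N A C : nat) :
  A.+2 <= t -> C <= 3 + 2 * (t.-1 - A) -> d <= N ->
  (3 * t - 4) * N < (3 * t - 1) * d -> 3 * N <= (3 * A + C) * (N - d) -> False.
Proof.
move=> hA hC dN hd; have h : 3 * A + C <= 3 * t - 1 by lia.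
move=> /leq_trans/(_ (leq_mul h (leqnn _))); nia.
Qed.

Section AndrasfaiErdosSos.
Variable V : finType.
Implicit Types (e : rel V) (x y z v : V) (S Q : {set V}).

Lemma simple_graphP e :
  reflect ((forall x, e x x = false) /\ symmetric e) (simple_graph e).
Proof.
apply: (iffP andP) => -[h1 h2]; split.
- by move=> x; apply/negbTE/(forallP h1).
- by move=> x y; apply/eqP/(forallP (forallP h2 x)).
- by apply/forallP => x; rewrite h1.
- by apply/forallP => x; apply/forallP => y; rewrite h2.
Qed.

Lemma cliqueP e S :
  reflect {in S &, forall x y, x != y -> e x y} (clique e S).
Proof.
apply: (iffP forall_inP) => h x.
  by move=> y xS yS xy; have /forall_inP/(_ y yS) := h x xS; rewrite xy.
by move=> xS; apply/forall_inP => y yS; apply/implyP; apply: h.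
Qed.

Lemma clique_sub e S Q : S \subset Q -> clique e Q -> clique e S.
Proof.
by move=> /subsetP sub /cliqueP h; apply/cliqueP => x y xS yS; apply: h; apply: sub.
Qed.

Lemma cliqueU1 e S x : symmetric e -> clique e S ->
  {in S, forall y, e x y} -> clique e (x |: S).
Proof.
move=> sy /cliqueP cS xS; apply/cliqueP => y z.
rewrite !inE => /orP[/eqP->|yS] /orP[/eqP->|zS]; rewrite ?eqxx // => h.
- exact: xS.
- by rewrite sy xS.
- exact: cS.
Qed.

Lemma clique_card_le e s S :
  ~~ has_complete_subgraph s.+1 e -> clique e S -> #|S| <= s.
Proof.
move=> nk cS; rewrite leqNgt; apply: contra nk => ltS.
have [Q QS cQ] : exists2 Q : {set V}, Q \subset S & #|Q| = s.+1.
  have szS : s < size (enum S) by rewrite -cardE.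
  exists [set x in take s.+1 (enum S)].
    by apply/subsetP => x; rewrite inE => /mem_take; rewrite mem_enum.
  rewrite cardsE; have /card_uniqP -> : uniq (take s.+1 (enum S)).
    by rewrite take_uniq ?enum_uniq.
  by rewrite size_takel.
by apply/existsP; exists Q; rewrite cQ eqxx (clique_sub QS).
Qed.

(** For distinct non-adjacent [x], [y], this certifies that joining them would create a complete
    graph on k+2 vertices. *)
Definition common_clique e (k : nat) x y Q : bool :=
  [&& #|Q| == k, clique e Q & Q \subset [set q | e x q && e y q]].

(* A failure of transitivity is a triple x, y, z with xz the only edge. By
   saturation xy and yz have common (t-1)-cliques Q1 and Q2; choose everything
   with |Q1 :&: Q2| maximal. Give weight 3 to the vertices of A = Q1 :&: Q2 and
   weight 1 to x, y, z and the rest of Q1 and Q2, for a total of at most 3t-1.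
   Every vertex v has non-neighbours of total weight at least 3: it misses a
   vertex of each of the t-cliques x Q1, y Q1, y Q2, z Q2, and if it missed just
   one vertex of Q1 and one of Q2, swapping v for them would enlarge A. *)
Lemma nonadjacency_trans_of_min_degree e t d : 0 < t ->
  simple_graph e -> ~~ has_complete_subgraph t.+1 e ->
  (forall x y, x != y -> ~~ e x y -> exists Q, common_clique e t.-1 x y Q) ->
  (forall x, d <= degree e x) -> (3 * t - 4) * #|V| < (3 * t - 1) * d ->
  forall x y z, ~~ e x y -> ~~ e y z -> ~~ e x z.
Proof.
move=> t0 /simple_graphP[ir sy] nk sat hd hV x0 y0 z0 nxy0 nyz0.
apply/negP => xz0.
pose P (p : V * V * V * {set V} * {set V}) :=
  let: (x, y, z, Q1, Q2) := p in
  [&& ~~ e x y, ~~ e y z, e x z, common_clique e t.-1 x y Q1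
    & common_clique e t.-1 y z Q2].
have [p0 Pp0] : exists p, P p.
  have [Q1 h1] : exists Q, common_clique e t.-1 x0 y0 Q.
    by apply: sat => //; apply: contraTneq xz0 => ->.
  have [Q2 h2] : exists Q, common_clique e t.-1 y0 z0 Q.
    by apply: sat => //; apply: contraTneq xz0 => <-.
  by exists (x0, y0, z0, Q1, Q2); rewrite /P nxy0 nyz0 xz0 h1 h2.
pose F (p : V * V * V * {set V} * {set V}) := #|p.1.2 :&: p.2|.
case: (arg_maxnP F Pp0) => -[[[[x y] z] Q1] Q2] Pp Fmax.
have {Pp} /and5P[nxy nyz xz cc1 cc2] := Pp.
have /and3P[/eqP c1 cl1 /subsetP s1] := cc1.
have /and3P[/eqP c2 cl2 /subsetP s2] := cc2.
have Q1x q : q \in Q1 -> e x q by move=> /s1; rewrite inE => /andP[].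
have Q1y q : q \in Q1 -> e y q by move=> /s1; rewrite inE => /andP[].
have Q2y q : q \in Q2 -> e y q by move=> /s2; rewrite inE => /andP[].
have Q2z q : q \in Q2 -> e z q by move=> /s2; rewrite inE => /andP[].
have xNy : x != y by apply: contraTneq xz => ->.
have yNz : y != z by apply: contraTneq xz => <-.
have xNz : x != z by apply: contraTneq xz => ->; rewrite ir.
have xQ1 : x \notin Q1 by apply/negP => /Q1x; rewrite ir.
have xQ2 : x \notin Q2 by apply/negP => /Q2y; rewrite sy (negbTE nxy).
have yQ1 : y \notin Q1 by apply/negP => /Q1y; rewrite ir.
have yQ2 : y \notin Q2 by apply/negP => /Q2y; rewrite ir.
have zQ1 : z \notin Q1 by apply/negP => /Q1y; rewrite (negbTE nyz).
have zQ2 : z \notin Q2 by apply/negP => /Q2z; rewrite ir.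
pose A := Q1 :&: Q2; pose B1 := Q1 :\: Q2; pose B2 := Q2 :\: Q1.
pose C := [set x; y; z] :|: B1 :|: B2.
pose M v := [set u | ~~ e v u].
(* Otherwise [v] would extend [q] to a clique on t+1 vertices. Each vertex belongs to its own
   [M v]. *)
have max_ext v q : clique e q -> #|q| = t -> exists2 u, u \in q & u \in M v.
  move=> clq cq; apply/exists_inP; apply: contraT => /exists_inPn h.
  have vq u : u \in q -> e v u by move=> /h; rewrite inE negbK.
  have vNq : v \notin q by apply/negP => /vq; rewrite ir.
  have := clique_card_le nk (cliqueU1 sy clq vq).
  by rewrite cardsU1 vNq cq ltnn.
have ext w Q k v : clique e Q -> #|Q| = t.-1 -> w \notin Q ->
    (forall q, q \in Q -> e w q) -> A \subset Q -> [disjoint A & M v] ->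
    k = Q :\: A -> exists2 u, u \in w |: k & u \in M v.
  move=> clQ cQ wQ hw AQ dis ->.
  have [|u uQ uM] := max_ext v (w |: Q) (cliqueU1 sy clQ hw).
    by rewrite cardsU1 wQ cQ add1n prednK.
  exists u => //; move: uQ; rewrite !inE => /orP[->//|->].
  rewrite andbT; apply/orP; right; apply/negP => uA.
  by have /pred0P/(_ u) := dis; rewrite /= !inE uA /=; move: uM; rewrite inE => ->.
have AQ1 : A \subset Q1 by apply: subsetIl.
have AQ2 : A \subset Q2 by apply: subsetIr.
have B1E : B1 = Q1 :\: A by rewrite /A setDIr setDv set0U.
have B2E : B2 = Q2 :\: A by rewrite /A setDIr setDv setU0.
have miss v : 3 <= 3 * #|A :&: M v| + #|C :&: M v|.
  have [Av|] := boolP (A :&: M v == set0); last first.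
    rewrite -card_gt0 => h; apply: leq_trans (leq_addr _ _).
    by rewrite -{1}[3]muln1 leq_mul2l.
  have dis : [disjoint A & M v] by rewrite -setI_eq0.
  rewrite (eqP Av) cards0 muln0 add0n.
  have three p q s : p \in C :&: M v -> q \in C :&: M v -> s \in C :&: M v ->
      p != q -> p != s -> q != s -> 2 < #|C :&: M v|.
    move=> hp hq hs pq ps qs.
    rewrite -[3]/(1 + 2) -(_ : #|p |: [set q; s]| = 1 + 2).
      by apply: subset_leq_card; rewrite !subUset !sub1set hp hq hs.
    by rewrite cardsU1 cards2 qs !inE negb_or pq ps.
  (* One missed vertex from each of the four t-cliques. Since [p] and [q] always differ, three
     distinct ones are at hand when p = x or q = z. *)
  have [p hp pM] := ext x Q1 B1 v cl1 c1 xQ1 Q1x AQ1 dis B1E.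
  have [p' hp' p'M] := ext y Q1 B1 v cl1 c1 yQ1 Q1y AQ1 dis B1E.
  have [q' hq' q'M] := ext y Q2 B2 v cl2 c2 yQ2 Q2y AQ2 dis B2E.
  have [q hq qM] := ext z Q2 B2 v cl2 c2 zQ2 Q2z AQ2 dis B2E.
  have inC u : u \in C = [|| u == x, u == y, u == z, u \in B1 | u \in B2].
    by rewrite !inE -!orbA.
  have CM u : u \in M v -> [|| u == x, u == y, u == z, u \in B1 | u \in B2] ->
      u \in C :&: M v by move=> uM uC; rewrite inE inC uM uC.
  have hpC : p \in C :&: M v.
    by apply: CM => //; case/setU1P: hp => ->; rewrite ?eqxx ?orbT.
  have hp'C : p' \in C :&: M v.
    by apply: CM => //; case/setU1P: hp' => ->; rewrite ?eqxx ?orbT.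
  have hq'C : q' \in C :&: M v.
    by apply: CM => //; case/setU1P: hq' => ->; rewrite ?eqxx ?orbT.
  have hqC : q \in C :&: M v.
    by apply: CM => //; case/setU1P: hq => ->; rewrite ?eqxx ?orbT.
  have sep X1 X2 Y1 Y2 u w : u \in X1 |: Y1 -> w \in X2 |: Y2 -> X1 != X2 ->
      X1 \notin Y2 -> X2 \notin Y1 -> [disjoint Y1 & Y2] -> u != w.
    move=> hu hw n1 n2 n3 dY; apply/eqP => uw; subst w.
    case/setU1P: hu => [E|uY1]; first subst u.
      by move: hw; rewrite !inE (negbTE n1) (negbTE n2).
    case/setU1P: hw => [E|uY2]; first by subst u; rewrite uY1 in n3.
    by have /pred0P/(_ u) := dY; rewrite /= uY1 uY2.
  have dB : [disjoint B1 & B2].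
    by apply/pred0P => u /=; rewrite !inE; do 2 case: (u \in _).
  have xB1 : x \notin B1 by rewrite inE (negbTE xQ1) andbF.
  have xB2 : x \notin B2 by rewrite inE (negbTE xQ2) andbF.
  have yB1 : y \notin B1 by rewrite inE (negbTE yQ1) andbF.
  have yB2 : y \notin B2 by rewrite inE (negbTE yQ2) andbF.
  have zB1 : z \notin B1 by rewrite inE (negbTE zQ1) andbF.
  have zB2 : z \notin B2 by rewrite inE (negbTE zQ2) andbF.
  have pq : p != q by apply: sep hp hq _ _ _ dB.
  have p'q : p' != q by apply: sep hp' hq _ _ _ dB.
  have pq' : p != q' by apply: sep hp hq' _ _ _ dB.
  case/setU1P: (hp) => [px|pB1].
    have pp' : p != p'.
      rewrite px; apply/eqP => E; move: hp'; rewrite -E !inE (negbTE xNy).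
      by rewrite (negbTE xQ1) andbF.
    exact: (three p p' q).
  case/setU1P: (hq) => [qz|qB2].
    have q'q : q' != q.
      rewrite qz; apply/eqP => E; move: hq'; rewrite E !inE (negbTE zQ2).
      by rewrite eq_sym (negbTE yNz) andbF.
    exact: (three p q' q).
  (* Now [p] is in [B1] and [q] in [B2]. If [v] misses nothing else in [C], putting [v] in place of
     [p] and of [q] gives cliques that share [v] and all of [A], against maximality. *)
  rewrite ltnNge; apply/negP => le2.
  have only u : u \in C -> u != p -> u != q -> e v u.
    move=> uC up uq; apply: contraLR le2 => vu; rewrite -ltnNge.
    by apply: (three u p q) => //; rewrite in_setI uC inE.
  have [xp yp zp] : [/\ x != p, y != p & z != p].
    by split; apply: contraTneq pB1 => <-.
  have [xq yq zq] : [/\ x != q, y != q & z != q].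
    by split; apply: contraTneq qB2 => <-.
  have vx : e v x by apply: only => //; rewrite inC eqxx.
  have vy : e v y by apply: only => //; rewrite inC eqxx !orbT.
  have vz : e v z by apply: only => //; rewrite inC eqxx !orbT.
  have vA u : u \in A -> e v u.
    move=> uA; apply: contraT => vu.
    by have /pred0P/(_ u) := dis; rewrite /= uA inE vu.
  have vQ1 u : u \in Q1 :\ p -> e v u.
    case/setD1P => up uQ1; have [uQ2|uQ2] := boolP (u \in Q2).
      by apply: vA; rewrite inE uQ1.
    apply: only => //; first by rewrite inC !inE uQ1 uQ2 /= !orbT.
    by apply: contraNneq uQ2 => ->; case/setDP: qB2.
  have vQ2 u : u \in Q2 :\ q -> e v u.
    case/setD1P => uq uQ2; have [uQ1|uQ1] := boolP (u \in Q1).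
      by apply: vA; rewrite inE uQ1.
    apply: only => //; first by rewrite inC !inE uQ1 uQ2 /= !orbT.
    by apply: contraNneq uQ1 => ->; case/setDP: pB1.
  have swap Q u w b : #|Q| = t.-1 -> clique e Q -> b \in Q ->
      (forall s, s \in Q -> e u s) -> (forall s, s \in Q -> e w s) ->
      (forall s, s \in Q :\ b -> e v s) -> e v u -> e v w ->
      common_clique e t.-1 u w (v |: (Q :\ b)).
    move=> cQ clQ bQ hu hw hv vu vw; apply/and3P; split.
    - rewrite cardsU1 (_ : v \notin _); first by rewrite -cQ (cardsD1 b Q) bQ.
      by apply/negP => /hv; rewrite ir.
    - by apply: cliqueU1 => //; apply: clique_sub clQ; apply: subD1set.
    - apply/subsetP => s /setU1P[->|/setD1P[_ sQ]]; rewrite inE.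
        by rewrite sy vu sy vw.
      by rewrite hu ?hw.
  have /setDP[pQ1 pQ2] := pB1; have /setDP[qQ2 qQ1] := qB2.
  have P' : P (x, y, z, v |: (Q1 :\ p), v |: (Q2 :\ q)).
    by rewrite /P nxy nyz xz !swap.
  have := Fmax _ P'; rewrite /F /= leqNgt => /negP; apply.
  have vA' : v \notin A by apply/negP => /vA; rewrite ir.
  apply: leq_trans (_ : #|v |: A| <= _); first by rewrite cardsU1 vA'.
  apply: subset_leq_card; apply/subsetP => s /setU1P[->|/setIP[sQ1 sQ2]].
    by rewrite !inE eqxx.
  rewrite !inE sQ1 sQ2 !andbT.
  rewrite (contraTneq _ sQ2) ?(contraTneq _ sQ1) ?orbT // => ->; assumption.
(* The edge xz is joined completely to [A], so [A] with [x] and [z] is a clique. *)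
have cA : #|A|.+2 <= t.
  have clA : clique e (x |: (z |: A)).
    apply: cliqueU1 => //; first apply: cliqueU1 => //.
    - exact: clique_sub cl1.
    - by move=> u /(subsetP AQ2)/Q2z.
    - by move=> u /setU1P[->//|/(subsetP AQ1)/Q1x].
  have := clique_card_le nk clA; rewrite !cardsU1 !inE (negbTE xNz).
  by rewrite (negbTE xQ1) (negbTE zQ1).
(* Double counting of non-adjacent pairs: each vertex has at most |V| - d non-neighbours. *)
have count S : \sum_v #|S :&: M v| <= #|S| * (#|V| - d).
  have -> : \sum_v #|S :&: M v| = \sum_(u in S) #|M u|.
    under eq_bigr do rewrite -sum1dep_card.
    rewrite (exchange_big_dep (mem S)) /=; last by move=> v u _ /andP[].
    apply: eq_bigr => u uS; rewrite -sum1dep_card.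
    by apply: eq_bigl => v; rewrite !inE uS sy.
  rewrite -sum_nat_const; apply: leq_sum => u _.
  have -> : M u = ~: [set w | e u w] by apply/setP => w; rewrite !inE.
  by rewrite cardsCs setCK leq_sub2l // hd.
have dV : d <= #|V|.
  by apply: leq_trans (hd x) _; rewrite /degree max_card.
have cC : #|C| <= 3 + 2 * (t.-1 - #|A|).
  have cB1 : #|B1| = t.-1 - #|A| by rewrite B1E cardsD (setIidPr AQ1) c1.
  have cB2 : #|B2| = t.-1 - #|A| by rewrite B2E cardsD (setIidPr AQ2) c2.
  apply: leq_trans (leq_card_setU _ _) _; rewrite cB2.
  rewrite mul2n -addnn addnA leq_add2r -cB1.
  apply: leq_trans (leq_card_setU _ _) _; rewrite leq_add2r.
  apply: leq_trans (leq_card_setU _ _) _; rewrite cards1 cards2.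
  by case: (x != y).
have : 3 * #|V| <= (3 * #|A| + #|C|) * (#|V| - d).
  rewrite mulnC -sum_nat_const.
  apply: leq_trans (leq_sum _ (fun v _ => miss v)) _.
  rewrite big_split -big_distrr /= mulnDl -mulnA.
  by rewrite leq_add ?leq_mul2l ?count.
exact: missed_weight_contradiction cA cC dV hV.
Qed.

(** Among the supergraphs without a complete subgraph on [s] vertices, take one with the most edges.
    Adding a missing edge xy creates such a subgraph, which must use both ends; deleting them leaves
    the common clique. *)
Lemma edge_maximal_supergraph e s :
  simple_graph e -> ~~ has_complete_subgraph s e ->
  exists e', [/\ simple_graph e', ~~ has_complete_subgraph s e',
    subrel e e' &
    forall x y, x != y -> ~~ e' x y -> exists Q, common_clique e' (s - 2) x y Q].
Proof.
move=> sg nk.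
pose P (g : {ffun V * V -> bool}) :=
  [&& simple_graph (rel_of g), ~~ has_complete_subgraph s (rel_of g)
    & [forall p, e p.1 p.2 ==> g p]].
have P_of (f : rel V) : simple_graph f -> ~~ has_complete_subgraph s f ->
    subrel e f -> P [ffun p => f p.1 p.2].
  move=> /simple_graphP[ir sy] nkf ef; apply/and3P; split.
  - by apply/simple_graphP; split => [x|x y]; rewrite /rel_of !ffunE //=.
  - apply: contra nkf => /existsP[S /andP[cS /cliqueP clS]].
    apply/existsP; exists S; rewrite cS; apply/cliqueP => x y xS yS xy.
    by have := clS x y xS yS xy; rewrite /rel_of ffunE.
  - by apply/forallP => p; rewrite ffunE; apply/implyP/ef.
have P0 := P_of e sg nk (fun _ _ h => h).
pose F (g : {ffun V * V -> bool}) := #|[set p | g p]|.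
case: (arg_maxnP F P0) => g /and3P[sgg nkg eg] gmax.
exists (rel_of g); split=> //.
  by move=> x y; have /implyP := forallP eg (x, y).
move=> x y xy nxy; have /simple_graphP[ir sy] := sgg.
pose f : rel V := fun u v =>
  rel_of g u v || ((u == x) && (v == y) || (u == y) && (v == x)).
have sf : simple_graph f.
  apply/simple_graphP; split => [u|u v]; rewrite /f.
    rewrite ir /=; apply/negbTE; rewrite negb_or; apply/andP; split.
      by apply/negP => /andP[/eqP-> h]; rewrite h in xy.
    by apply/negP => /andP[/eqP-> h]; rewrite eq_sym h in xy.
  by rewrite sy orbC [in RHS]orbC; congr (_ || _); rewrite orbC andbC [X in _ || X]andbC.
have ef : subrel e f.
  move=> u v euv; have /implyP/(_ euv) /= := forallP eg (u, v).
  by rewrite /f /rel_of => ->.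
have [/existsP[S /andP[/eqP cS /cliqueP clS]]|nkf] :=
    boolP (has_complete_subgraph s f); last first.
  have := gmax _ (P_of f sf nkf ef); rewrite /F /= leqNgt => /negP; case.
  apply: proper_card; apply/properP; split.
    by apply/subsetP => -[u v]; rewrite !inE ffunE /f /rel_of /= => ->.
  exists (x, y); first by rewrite inE ffunE /f /= !eqxx /= orbT.
  by rewrite inE.
have clg w u v : (w == x) || (w == y) -> u \in S -> v \in S -> u != v ->
    u != w -> v != w -> rel_of g u v.
  move=> hw uS vS uv uw vw; case/orP: (clS u v uS vS uv) => // h; exfalso.
  by case/orP: hw uw vw h => /eqP-> /negbTE-> /negbTE->; rewrite ?andbF.
have inS w : (w == x) || (w == y) -> w \in S.
  move=> hw; apply: contraT => wS; case/existsP: nkg; exists S.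
  rewrite cS eqxx; apply/cliqueP => u v uS vS uv.
  by apply: (clg w) => //; apply: contraNneq wS => <-.
have xS : x \in S by apply: inS; rewrite eqxx.
have yS : y \in S by apply: inS; rewrite eqxx orbT.
exists (S :\ x :\ y); apply/and3P; split.
- have := cardsD1 x S; have := cardsD1 y (S :\ x).
  rewrite !inE eq_sym xy xS yS cS => -> /= ->.
  by rewrite !add1n subn2.
- apply/cliqueP => u v; rewrite !inE => /and3P[uy ux uS] /and3P[vy vx vS] uv.
  by apply: (clg x); rewrite ?eqxx.
- apply/subsetP => u; rewrite !inE => /and3P[uy ux uS].
  by apply/andP; split; [apply: (clg y)|apply: (clg x)];
    rewrite ?eqxx ?orbT // eq_sym.
Qed.

(** Non-adjacency is an equivalence relation, and representatives of distinct classes are adjacent.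
    They form a clique, hence number at most [t], and serve as colours. *)
Lemma coloring_of_nonadjacency_trans e t :
  simple_graph e -> ~~ has_complete_subgraph t.+1 e ->
  (forall x y z, ~~ e x y -> ~~ e y z -> ~~ e x z) ->
  exists c : V -> 'I_t, forall x y, e x y -> c x != c y.
Proof.
move=> /simple_graphP[ir sy] nk tr.
(* [pick] depends only on the set of non-neighbours, so equivalent vertices get the same
   representative. That set contains [x], so the default is never returned. *)
pose rep x := odflt x [pick y | ~~ e x y].
have repP x : ~~ e x (rep x) by rewrite /rep; case: pickP => //= _; rewrite ir.
have rep_eq x y : ~~ e x y -> rep x = rep y.
  move=> nxy; rewrite /rep.
  have E : [pred u | ~~ e x u] =1 [pred u | ~~ e y u].
    move=> u /=; apply/idP/idP => h; apply: tr h => //; by rewrite sy.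
  rewrite (eq_pick E); case: pickP => //= /(_ y) /=.
  by rewrite ir.
pose I := rep @: [set: V].
have cl : clique e I.
  apply/cliqueP => _ _ /imsetP[x _ ->] /imsetP[y _ ->].
  apply: contraNT => h; apply/eqP/rep_eq.
  by apply: tr (repP x) (tr _ _ _ h _); rewrite sy.
have cI := clique_card_le nk cl.
have inI x : rep x \in I by apply: imset_f; rewrite inE.
exists (fun x => widen_ord cI (enum_rank_in (inI x) (rep x))) => x y exy.
apply/eqP => /(congr1 val) /= h.
have E : rep x = rep y.
  rewrite -(enum_rankK_in (inI x) (inI x)) -[RHS](enum_rankK_in (inI y) (inI y)).
  by congr enum_val; apply: val_inj.
have h1 : ~~ e (rep x) y by rewrite E sy.
by have := tr _ _ _ (repP x) h1; rewrite exy.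
Qed.

(* The Andrasfai-Erdos-Sos theorem. *)
Theorem coloring_of_min_degree e t d : 0 < t ->
  simple_graph e -> ~~ has_complete_subgraph t.+1 e ->
  (forall x, d <= degree e x) -> (3 * t - 4) * #|V| < (3 * t - 1) * d ->
  exists c : V -> 'I_t, forall x y, e x y -> c x != c y.
Proof.
move=> t0 sg nk hd hV.
have [f [sf nkf ef sat]] := edge_maximal_supergraph sg nk.
have [|c hc] := coloring_of_nonadjacency_trans sf nkf.
- apply: (@nonadjacency_trans_of_min_degree f t d) => //.
  + by move=> x y xy /sat; rewrite subSS subn1; apply.
  + move=> x; apply: leq_trans (hd x) _.
    by apply: subset_leq_card; apply/subsetP => y; rewrite !inE; apply: ef.
- by exists c => x y /ef /hc.
Qed.
End AndrasfaiErdosSos.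

(** * Minimum degree and fibre sizes *)

Lemma min_degree_le (V : finType) (e : rel V) x : min_degree e <= degree e x.
Proof.
rewrite /min_degree; have := mem_index_enum x.
elim: (index_enum V) => // y l IH; rewrite inE big_cons geq_min.
by case/predU1P => [->|/IH->]; rewrite ?leqnn ?orbT.
Qed.

Lemma leq_min_degree (V : finType) (e : rel V) d :
  d <= #|V| -> (forall x, d <= degree e x) -> d <= min_degree e.
Proof.
move=> dV hd; rewrite /min_degree; elim/big_ind: _ => // x y.
by rewrite leq_min => -> ->.
Qed.

Lemma card_fst_fiber n r (i : 'I_r) :
  #|[set v : vertex n r | v.1 == i]| = n.
Proof.
rewrite (_ : [set _ | _] = setX [set i] setT); last first.
  by apply/setP => v; rewrite !inE andbT.
by rewrite cardsX cards1 cardsT card_ord mul1n.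
Qed.

Lemma card_vertex n r : #|vertex n r| = r * n.
Proof. by rewrite card_prod !card_ord. Qed.

Lemma card_fibers_sum (T : finType) (t : nat) (c : T -> 'I_t) (P : pred T) :
  \sum_j #|[set v | P v && (c v == j)]| = #|[set v | P v]|.
Proof.
rewrite -sum1dep_card (partition_big c predT) //=.
by apply: eq_bigr => j _; rewrite -sum1dep_card.
Qed.

(** * Upper bound *)

(** A vertex in part i with colour j has no neighbour in that part or colour class, whose union has
    n + u_j - x_ij vertices. This gives the inequality u_j <= D + x_ij that [class_sizes_bound]
    requires. *)
Lemma colored_degree_bound (n m t a r : nat) (e : rel (vertex n r)) d
    (c : vertex n r -> 'I_t) :
  0 < n -> 1 < m -> 0 < a < t -> r = m * t - a ->
  parts_independent (fun x : vertex n r => x.1) e ->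
  (forall x y, e x y -> c x != c y) -> (forall x, d <= degree e x) ->
  (m - 1) * (r - 1) * n <= (m * t - 2) * ((r - 1) * n - d).
Proof.
(* Used with [N] = rn, [N'] = (r-1)n, [k] = x_ij, [q] = u_j and [s] the degree of a vertex. *)
have arith N N' k q s : N = N' + n -> k <= n -> d <= s -> n + q - k <= N ->
  s <= N - (n + q - k) -> q <= N' - d + k by clear; lia.
move=> n0 m1 at_ rE ind hc hd.
pose x i j := #|[set v : vertex n r | (v.1 == i) && (c v == j)]|.
apply: (@class_sizes_bound n m t a r _ x) => // [i|i j].
  by rewrite -[RHS](@card_fst_fiber n r i) -(card_fibers_sum c).
rewrite /x card_gt0 => /set0Pn[v]; rewrite inE => /andP[/eqP vi /eqP vj].
have -> : \sum_k x k j = #|[set v | c v == j]|.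
  rewrite -(card_fibers_sum (fun v : vertex n r => v.1)).
  by apply: eq_bigr => k _; rewrite /x; apply: eq_card => u; rewrite !inE andbC.
have : [set u | e v u] \subset ~: ([set u | u.1 == i] :|: [set u | c u == j]).
  apply/subsetP => u; rewrite !inE negb_or => evu; apply/andP; split.
    apply/negP => /eqP h; have := forallP (forallP ind v) u.
    by rewrite vi h eqxx evu.
  by rewrite -vj eq_sym; apply: hc.
move=> /subset_leq_card; rewrite [X in _ <= X]cardsCs setCK card_vertex.
have := max_card (mem ([set u | u.1 == i] :|: [set u | c u == j])).
rewrite card_vertex cardsU card_fst_fiber -/(degree e v).
have -> : [set u | u.1 == i] :&: [set u | c u == j] =
          [set u | (u.1 == i) && (c u == j)] by apply/setP => u; rewrite !inE.
have := hd v; have : #|[set u | (u.1 == i) && (c u == j)]| <= n.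
  rewrite -[X in _ <= X](@card_fst_fiber n r i); apply: subset_leq_card.
  by apply/subsetP => u; rewrite !inE => /andP[].
have r0 : 0 < r by rewrite (leq_ltn_trans _ (ltn_ord i)).
have : r * n = (r - 1) * n + n by rewrite mulnBl mul1n subnK // leq_pmull.
exact: arith.
Qed.

(** Put N = mt-2, T = 3t-1, p = r-1, D = pn - d. The long hypothesis, a common consequence of
    conditions (i) and (ii), amounts to T(N + (m-1)p) <= 3rN. With ND < (m-1)pn it yields T(n+D) <
    3rn, and rn - d <= n + D finishes. *)
Lemma degree_threshold (n m t a r d : nat) :
  1 < m -> 0 < a < t -> r = m * t - a ->
  a * (3 * t - 1) * (m * t - 2) <=
    r * (m * t - 2) + (a - 1) * t * (3 * t - 1) * (m - 1) ->
  (m * t - 2) * ((r - 1) * n - d) < (m - 1) * (r - 1) * n ->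
  (3 * t - 4) * (r * n) < (3 * t - 1) * d.
Proof.
move=> m1 /andP[a0 at_] rE.
have mat : m * a + m <= m * t by rewrite -mulnSr leq_mul2l at_ orbT.
have ma : a + a <= m * a by rewrite addnn -mul2n leq_mul2r m1 orbT.
have [N0 [rho1 t1]] : 0 < m * t - 2 /\ 0 < r /\ 1 < t by lia.
have t0 := ltnW t1.
have [NE rhoE] : m * t = (m * t - 2) + 2 /\ r = (r - 1).+1 by lia.
have NrE : m * t - 2 = (r - 1) + (a - 1) by lia.
have TE : 3 * t = (3 * t - 1).+1 by lia.
have T3 : 3 * t - 4 = (3 * t - 1) - 3 by lia.
rewrite T3; move: (m * t - 2) (r - 1) (3 * t - 1) N0 NE rhoE NrE TE => N p T.
(* From here on [m] and [a] stand for m-1 and a-1. *)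
case: m m1 mat ma {rE} => // m _ _ _; case: a a0 at_ => // a _ _.
rewrite !subSS !subn0 => N0 mt rp Nr Tt key.
have key' : t * (T * (N + m * p)) <= t * (3 * r * N).
  have : t * (3 * r * N) + a.+1 * T * N = t * (T * (N + m * p)) + r * N + a * t * T * m.
    have -> : t * (T * (N + m * p)) + r * N + a * t * T * m = N * (T * (m.+1 * t) + r).
      by rewrite Nr; ring.
    rewrite mt (_ : t * (3 * r * N) = 3 * t * r * N); last by ring.
    by rewrite Tt rp Nr; ring.
  by move: key; lia.
rewrite leq_pmul2l // in key'.
have le_rn : r * n <= n + (p * n - d) + d by rewrite rp mulSn; lia.
move: (p * n - d) le_rn => D le_rn hlt.
have T1 : T * (n + D) < 3 * (r * n).
  rewrite -(ltn_pmul2l N0).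
  have h1 : T * (N * D) < T * (m * p * n) by rewrite ltn_pmul2l //; lia.
  have h2 : T * (N + m * p) * n <= 3 * r * N * n by rewrite leq_mul2r key' orbT.
  apply: leq_trans (_ : (T * (N + m * p) * n) <= _);
    last by move: h2; congr (_ <= _); ring.
  rewrite (_ : N * (T * (n + D)) = T * N * n + T * (N * D)); last by ring.
  rewrite (_ : T * (N + m * p) * n = T * N * n + T * (m * p * n)); last by ring.
  by rewrite ltn_add2l.
rewrite mulnBl ltn_subLR; last by rewrite leq_mul2r; apply/orP; right; lia.
have : T * (r * n) <= T * (n + D + d) by rewrite leq_mul2l le_rn orbT.
by rewrite mulnDr; move: T1; clear; lia.
Qed.

Lemma fmax_upper (n m t a r : nat) :
  0 < n -> 1 < m -> 1 < t -> 0 < a < t -> r = m * t - a ->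
  a * (3 * t - 1) * (m * t - 2) <=
    r * (m * t - 2) + (a - 1) * t * (3 * t - 1) * (m - 1) ->
  (m - 1) * (r - 1) * n <= (m * t - 2) * ((r - 1) * n - fmax n r t.+1).
Proof.
move=> n0 m1 t1 at_ rE key.
have [e /and3P[sg ind nk] eE] := @fmax_attained n r t.+1 (ltnW t1).
have hd x : fmax n r t.+1 <= degree e x by rewrite -eE min_degree_le.
rewrite leqNgt; apply/negP => hlt.
have [|c hc] := @coloring_of_min_degree _ e t _ (ltnW t1) sg nk hd.
  by rewrite card_vertex; apply: degree_threshold key hlt.
by have := colored_degree_bound n0 m1 at_ rE ind hc hd; rewrite leqNgt hlt.
Qed.

(** * Lower bound construction *)

Lemma card_ord_lt n x : x <= n -> #|[set k : 'I_n | k < x]| = x.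
Proof.
move=> xn; rewrite (_ : [set _ | _] = widen_ord xn @: setT).
  rewrite card_imset ?cardsT ?card_ord // => u v /(congr1 val) /= h.
  exact: val_inj.
apply/setP => k; rewrite inE; apply/idP/imsetP => [kx|[u _ ->]];
  last by rewrite /= ltn_ord.
by exists (Ordinal kx) => //; apply: val_inj.
Qed.

Lemma card_divn_fiber r m j : 0 < m -> #|[set i : 'I_r | i %/ m == j]| <= m.
Proof.
move=> m0; pose f (i : 'I_r) := Ordinal (ltn_pmod i m0).
rewrite -(card_in_imset (f := f)); first by rewrite -[X in _ <= X]card_ord max_card.
move=> u v; rewrite !inE => /eqP uj /eqP vj /(congr1 val) /= h.
by apply: val_inj; rewrite /= (divn_eq u m) (divn_eq v m) uj vj h.
Qed.

(** Outside its own part a vertex misses at most (m-1)x vertices. In one of the first t-1 classes,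
    these are [x] in each of at most m-1 other parts. The last class has at most rn - m(t-1)x
    vertices, at least n-x of them in the part considered, and (r-1)n <= (mt-2)x bounds the
    difference by (m-1)x. *)
Lemma fmax_lower (n m t a r x : nat) :
  1 < m -> 1 < t -> 0 < a <= m -> r = m * t - a -> x <= n ->
  (r - 1) * n <= (m * t - 2) * x -> (r - 1) * n <= fmax n r t.+1 + (m - 1) * x.
Proof.
move=> m1 t1 /andP[a0 am] rE xn hx.
have m0 : 0 < m by apply: ltnW.
have mt : m * t = m * (t - 1) + m
  by rewrite mulnBr muln1 subnK // leq_pmulr // ltnW.
pose big (v : vertex n r) := (v.1 < m * (t - 1)) && (v.2 < x).
pose c (v : vertex n r) := if big v then v.1 %/ m else t - 1.
have c_big v : big v -> v.1 %/ m < t - 1.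
  by move=> /andP[h _]; rewrite ltn_divLR // mulnC.
have c_lt v : c v < t.
  rewrite /c; case: ifP => [/c_big h|_]; last by rewrite subn1 prednK // ltnW.
  by apply: leq_trans h _; rewrite leq_subr.
pose e : rel (vertex n r) := fun u v => (u.1 != v.1) && (c u != c v).
rewrite addnC -leq_subLR; apply: leq_trans (_ : min_degree e <= _); last first.
  apply: (@fmax_ub n r t.+1 _ (fun v : vertex n r => v.1)).
  - exact: card_fst_fiber.
  - apply/simple_graphP; split => [u|u v]; rewrite /e ?eqxx //.
    by rewrite eq_sym [X in _ && ~~ X]eq_sym.
  - apply/forallP => u; apply/forallP => v; apply/implyP => /eqP uv.
    by rewrite /e uv eqxx.
  (* A clique has at most one vertex of each of the [t] colours. *)
  - apply/existsP => -[S /andP[/eqP cS /cliqueP cl]].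
    pose f v := Ordinal (c_lt v).
    have : #|f @: S| <= t by rewrite -[X in _ <= X]card_ord max_card.
    rewrite card_in_imset ?cS ?ltnn // => u v uS vS /(congr1 val) /= h.
    by apply/eqP; apply: contraT => /(cl _ _ uS vS); rewrite /e h eqxx andbF.
(* By a <= m, there are enough parts for all t-1 blocks. *)
have rr : m * (t - 1) <= r by rewrite rE mt; lia.
have r0 : 0 < r by apply: leq_trans rr; rewrite muln_gt0 m0 subn_gt0.
have rn : r * n = (r - 1) * n + n by rewrite mulnBl mul1n subnK // leq_pmull.
apply: leq_min_degree => [|[i k]].
  by rewrite card_vertex rn; lia.
pose X := [set v | (c v == c (i, k)) && (v.1 != i)].
have hdeg : r * n <= degree e (i, k) + (n + #|X|).
  have /subset_leq_card : ~: [set v | e (i, k) v] \subset [set v | v.1 == i] :|: X.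
    apply/subsetP => v; rewrite !inE /e /= negb_and !negbK (eq_sym i) (eq_sym (c _)).
    by case: eqP => //= _ ->.
  move=> /leq_trans/(_ (leq_card_setU _ _)).
  by rewrite card_fst_fiber cardsCs setCK card_vertex /degree; lia.
suff hX : #|X| <= (m - 1) * x.
  by move: hdeg hX; rewrite rn; clear; lia.
have [bik|nbik] := boolP (big (i, k)).
  pose I := [set i' : 'I_r | i' %/ m == i %/ m].
  have hI : #|I :\ i| <= m - 1.
    have := card_divn_fiber r (i %/ m) m0; rewrite -/I (cardsD1 i) inE eqxx.
    by lia.
  apply: leq_trans (_ : #|setX (I :\ i) [set k : 'I_n | k < x]| <= _).
    apply: subset_leq_card; apply/subsetP => -[i' k']; rewrite !inE /=.
    rewrite /c bik; case: ifP => [/andP[_ /= ->]|_] /andP[/eqP E ->].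
      by rewrite E eqxx.
    by have := c_big _ bik; rewrite -E ltnn.
  by rewrite cardsX card_ord_lt // leq_mul2r hI orbT.
pose S := [set v | c v == t - 1].
have cS : #|S| <= r * n - m * (t - 1) * x.
  pose B := setX [set i : 'I_r | i < m * (t - 1)] [set k : 'I_n | k < x].
  apply: leq_trans (_ : #|~: B| <= _); last first.
    by rewrite cardsCs setCK card_vertex cardsX !card_ord_lt.
  apply: subset_leq_card.
  apply/subsetP => v; rewrite !inE /c -/(big v); case: ifP => // /c_big h.
  by rewrite ltn_eqF.
have cSi : n - x <= #|S :&: [set v | v.1 == i]|.
  have -> : n - x = #|setX [set i] (~: [set k : 'I_n | k < x])|.
    by rewrite cardsX cards1 mul1n cardsCs setCK card_ord card_ord_lt.
  apply: subset_leq_card; apply/subsetP => v; rewrite !inE /c /big.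
  by move=> /andP[-> /negbTE->]; rewrite andbF eqxx.
have -> : X = S :\: [set v | v.1 == i].
  have cik : c (i, k) = t - 1 by rewrite /c (negbTE nbik).
  by apply/setP => v; rewrite !inE cik andbC.
rewrite cardsD.
have mx : m * (t - 1) * x + m * x = m * t * x by rewrite -mulnDl -mt.
move: hx; rewrite !mulnBl mul1n => hx.
have : n <= r * n by rewrite leq_pmull.
have : x <= m * x by rewrite leq_pmull.
have : 2 * x <= m * t * x by rewrite leq_mul2r; apply/orP; right; lia.
have : m * (t - 1) * x <= r * n by rewrite leq_mul.
move: cS cSi mx hx xn; clear.
move: #|S| #|_| (m * (t - 1) * x) (m * t * x) (m * x) (r * n) => *; lia.
Qed.

(** * Rational conditions, ceilings and the final bounds *)

Local Open Scope ring_scope.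

(** As 1/n >= 0, the right side of condition (ii) is nonnegative; multiply it by
    t(3t-1)(m-1)(mt-2). *)
Lemma clear_denominators (n m t a r : nat) :
  (1 < m)%N -> (1 < t)%N -> (0 < a)%N ->
  n%:R^-1 <= r%:R / (t%:R * (3 * t%:R - 1) * (m%:R - 1))
             - a%:R / (t%:R * (m%:R - 1))
             + (a%:R - 1) / (m%:R * t%:R - 2) :> rat ->
  (a * (3 * t - 1) * (m * t - 2) <=
    r * (m * t - 2) + (a - 1) * t * (3 * t - 1) * (m - 1))%N.
Proof.
move=> m1 t1 a0.
have -> : 3 * t%:R - 1 = (3 * t - 1)%N%:R :> rat
  by rewrite natrB ?natrM //; lia.
have -> : m%:R - 1 = (m - 1)%N%:R :> rat by rewrite natrB // ltnW.
have -> : a%:R - 1 = (a - 1)%N%:R :> rat by rewrite natrB.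
have -> : m%:R * t%:R - 2 = (m * t - 2)%N%:R :> rat.
  by rewrite natrB ?natrM // (leq_mul (ltnW m1) t1).
have T0 : (0 < 3 * t - 1)%N by lia.
have M0 : (0 < m - 1)%N by lia.
have N0 : (0 < m * t - 2)%N by have := leq_mul m1 t1; lia.
have t0 : (0 < t)%N by lia.
rewrite -(ler_nat rat) natrD !natrM; move: T0 M0 N0 t0.
rewrite -!(ltr_nat rat).
move: (3 * t - 1)%N%:R (m - 1)%N%:R (m * t - 2)%N%:R t%:R r%:R a%:R (a - 1)%N%:R.
move=> T M N t' r' a' b T0 M0 N0 t0 h.
have {h} : 0 <= r' / (t' * T * M) - a' / (t' * M) + b / N.
  by apply: le_trans h; rewrite invr_ge0 ler0n.
have W : 0 < t' * T * M * N by rewrite !mulr_gt0.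
rewrite -(pmulr_rge0 _ W).
have -> : t' * T * M * N * (r' / (t' * T * M) - a' / (t' * M) + b / N) =
    r' * N + b * t' * T * M - a' * T * N.
  by field; rewrite !gt_eqF.
by rewrite subr_ge0.
Qed.

Theorem theorem1p3 (n m t a r : nat)
  (hn : (1 <= n)%N) (hm : (2 <= m)%N) (ht : (3 <= t)%N)
  (ha2 : (2 <= a)%N) (ha : (a <= minn m (t - 1))%N)
  (hr : r = (m * t - a)%N)
  (hcond :
    (a * (3 * t - 1) <= r)%N \/
    n%:R^-1 <= r%:R / (t%:R * (3 * t%:R - 1) * (m%:R - 1))
               - a%:R / (t%:R * (m%:R - 1))
               + (a%:R - 1) / (m%:R * t%:R - 2) :> rat) :
  (r%:Z - 1) * n%:Z
    - (m%:Z - 1) * Num.ceil ((r%:R - 1) * n%:R / (m%:R * t%:R - 2) : rat)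
    <= (fmax n r (t + 1))%:Z
  /\
  (fmax n r (t + 1))%:Z
    <= (r%:Z - 1) * n%:Z
       - Num.ceil ((m%:R - 1) * (r%:R - 1) * n%:R / (m%:R * t%:R - 2) : rat).
Proof.
have a0 : (0 < a)%N by apply: ltnW.
have t1 : (1 < t)%N by apply: ltnW.
have [am at_] : (a <= m)%N /\ (a < t)%N by lia.
have mt4 : (4 <= m * t)%N by apply: (@leq_mul 2 2).
have N0 : (0 < m * t - 2)%N by lia.
have mat : (m * a + m <= m * t)%N by rewrite -mulnSr leq_mul2l at_ orbT.
have r1 : (1 < r)%N by have := leq_pmull a (ltnW hm); lia.
have r0 := ltnW r1.
rewrite addn1.
have -> : r%:Z - 1 = (r - 1)%N%:Z by rewrite subzn.
have -> : m%:Z - 1 = (m - 1)%N%:Z by rewrite subzn // ltnW.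
have -> : m%:R - 1 = (m - 1)%N%:R :> rat by rewrite natrB // ltnW.
have -> : r%:R - 1 = (r - 1)%N%:R :> rat by rewrite natrB.
have -> : m%:R * t%:R - 2 = (m * t - 2)%N%:R :> rat.
  by rewrite natrB ?natrM //; lia.
have N0' : 0 < (m * t - 2)%N%:R :> rat by rewrite ltr0n.
split.
  set X := _ / _ : rat.
  have X0 : 0 <= X by rewrite divr_ge0 ?mulr_ge0 ?ler0n.
  have z0 : 0 <= Num.ceil X by rewrite ceil_ge0 (lt_le_trans _ X0) // ltrN10.
  (* The ceiling is at most [n] because r-1 <= mt-2, so it is an admissible [x] for [fmax_lower]. *)
  have /= := ceil_ge X; have : Num.ceil X <= n%:Z.
    rewrite ceil_le_int ler_pdivrMr // -[n%:Z%:~R]/(n%:R) -!natrM ler_nat mulnC.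
    by rewrite leq_mul2l; apply/orP; right; lia.
  case: (Num.ceil X) z0 => // x _ xn.
  rewrite ler_pdivrMr // -[(Posz x)%:~R]/(x%:R) -!natrM ler_nat mulnC => hx.
  rewrite lez_nat in xn.
  rewrite lerBlDr -!PoszM -PoszD lez_nat.
  apply: (@fmax_lower n m t a) => //; first by rewrite a0.
  by rewrite mulnC (leq_trans hx) // mulnC.
(* Condition (i), multiplied by mt-2, gives this even without the last summand. *)
have key : (a * (3 * t - 1) * (m * t - 2) <=
    r * (m * t - 2) + (a - 1) * t * (3 * t - 1) * (m - 1))%N.
  case: hcond => [h|]; last exact: clear_denominators.
  by apply: leq_trans (leq_addr _ _); rewrite leq_mul2r h orbT.
have up : ((m - 1) * (r - 1) * n <= (m * t - 2) * ((r - 1) * n - fmax n r t.+1))%N.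
  by apply: (@fmax_upper n m t a) => //; rewrite a0.
have M0 : (0 < (m - 1) * (r - 1) * n)%N by rewrite !muln_gt0 !subn_gt0 hm r1.
(* The positive left side of [up] forces (r-1)n - f > 0, so the truncated subtraction there is an
   integer subtraction. *)
have le_f : (fmax n r t.+1 <= (r - 1) * n)%N.
  by have := leq_trans M0 up; rewrite muln_gt0 N0 subn_gt0 => /ltnW.
rewrite lerBrDr -lerBrDl -PoszM subzn // ceil_le_int ler_pdivrMr //.
by rewrite -[_%:~R]/(_%:R) -!natrM ler_nat [X in (_ <= X)%N]mulnC.
Qed.
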